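(* Let $P=\{p_1,\ldots,p_n\}$ and $Q=\{q_1,\ldots,q_n\}$ be sets of $n$ points in $\mathbb{R}^2$, with $p_i=(x_i,y_i)$ and $q_i=(x_i^\prime,y_i^\prime)$ in rectangular coordinates, $i=1,\ldots,n$. For a $2\times 2$ rotation matrix $U$ let $\Delta(P,Q,U)=\sum_{i=1}^n\|Uq_i-p_i\|^2$. Let $$a=\sum_{i=1}^n x^\prime_i x_i+\sum_{i=1}^n y^\prime_i y_i,\qquad b=\sum_{i=1}^n y^\prime_i x_i-\sum_{i=1}^n x^\prime_i y_i.$$ If $a=b=0$, then $U=I$, the $2\times 2$ identity matrix, minimizes $\Delta(P,Q,U)$ over all $2\times 2$ rotation matrices $U$. Otherwise, with $c=\sqrt{a^2+b^2}$ and $$\hat U=\begin{pmatrix} a/c & b/c\\ -b/c & a/c\end{pmatrix},$$ $U=\hat U$ minimizes $\Delta(P,Q,U)$ over all $2\times 2$ rotation matrices $U$.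
   Context: A rotation matrix is a real orthogonal matrix of determinant one. $\|\cdot\|$ is the Euclidean norm, and points are treated as column vectors when multiplied by matrices. The points in $P$ and in $Q$ are indexed lists $p_1,\ldots,p_n$ and $q_1,\ldots,q_n$. *)

(* Defs.v *)
From mathcomp Require Import all_boot all_order all_algebra.
From mathcomp Require Import reals.

Set Implicit Arguments.
Unset Strict Implicit.
Unset Printing Implicit Defensive.

Import Order.TTheory GRing.Theory Num.Theory.
Local Open Scope ring_scope.

(* The norm that MathComp-Analysis puts on matrices is the sup norm, hence
   this explicit Euclidean one. *)
Definition enorm (R : realType) (m : nat) (v : 'cV[R]_m) : R :=
  Num.sqrt (\sum_(k < m) v k 0 ^+ 2).

Definition rotation (R : realType) (m : nat) (U : 'M[R]_m) : Prop :=
  U^T *m U = 1%:M /\ \det U = 1.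

Definition Delta (R : realType) (n : nat) (p q : 'I_n -> 'cV[R]_2)
    (U : 'M[R]_2) : R :=
  \sum_(i < n) enorm (U *m q i - p i) ^+ 2.

Definition minimizes_Delta (R : realType) (n : nat) (p q : 'I_n -> 'cV[R]_2)
    (U : 'M[R]_2) : Prop :=
  rotation U /\ forall V : 'M[R]_2, rotation V -> Delta p q U <= Delta p q V.

Definition xcoord (R : realType) (v : 'cV[R]_2) : R := v 0 0.
Definition ycoord (R : realType) (v : 'cV[R]_2) : R := v 1 0.

(* Entries are given row by row. *)
Definition mx22 (R : realType) (a00 a01 a10 a11 : R) : 'M[R]_2 :=
  \matrix_(i < 2, j < 2)
    if i == 0 then (if j == 0 then a00 else a01)
    else (if j == 0 then a10 else a11).

(* Main.v *)
Require Import Defs.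
From mathcomp Require Import all_boot all_order all_algebra.
From mathcomp Require Import reals.
From mathcomp Require Import ring lra.

Import Order.TTheory GRing.Theory Num.Theory.
Local Open Scope ring_scope.

(** Every plane rotation has the form [rot u v] with [u ^+ 2 + v ^+ 2 = 1].
    Expanding the squared distances and using that a rotation preserves norms,
    [Delta p q (rot u v)] is the constant [\sum_i (|q_i|^2 + |p_i|^2)] minus
    [2 * (a * u + b * v)] ([Delta_rot]).  So minimizing [Delta] over rotations
    is maximizing the linear form [a * u + b * v] over the unit circle
    ([minimizes_Delta_rot]).  If [a = b = 0] the form is constant and any
    rotation is optimal, the identity in particular; otherwise, by
    Cauchy-Schwarz, its maximum is the norm [c] of [(a, b)], attained at the
    normalized vector [(a / c, b / c)]. *)

(** The rotation of angle [t] is [rot (cos t) (- sin t)]; the clockwise sign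
    makes the first row [(u, v)] pair with [(a, b)] in [Delta_rot]. *)
Definition rot {R : realType} (u v : R) : 'M[R]_2 := mx22 u v (- v) u.

Lemma det_mx2 (R : comNzRingType) (U : 'M[R]_2) :
  \det U = U 0 0 * U 1 1 - U 0 1 * U 1 0.
Proof.
rewrite (expand_det_row _ 0) !big_ord_recl big_ord0 /cofactor !det_mx11 !mxE /=.
have -> : lift 0 0 = 1 :> 'I_2 by apply/val_inj.
have -> : lift 1 0 = 0 :> 'I_2 by apply/val_inj.
by rewrite expr0 expr1; ring.
Qed.

Lemma mx2_eq (R : pzRingType) (U V : 'M[R]_2) :
  U 0 0 = V 0 0 -> U 0 1 = V 0 1 -> U 1 0 = V 1 0 -> U 1 1 = V 1 1 -> U = V.
Proof.
move=> e00 e01 e10 e11; apply/matrixP => i j.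
have ord2P (k : 'I_2) : k = 0 \/ k = 1.
  by case: k => [[|[|//]] lt_k2]; [left | right]; apply/val_inj.
by have [-> | ->] := ord2P i; have [-> | ->] := ord2P j.
Qed.

Lemma sum_ord2 (R : nmodType) (F : 'I_2 -> R) : \sum_(k < 2) F k = F 0 + F 1.
Proof.
rewrite !big_ord_recl big_ord0 addr0; congr (_ + F _); exact/val_inj.
Qed.

Lemma rotation_rot (R : realType) (u v : R) :
  u ^+ 2 + v ^+ 2 = 1 -> rotation (rot u v).
Proof.
move=> uv1; split; last by rewrite det_mx2 !mxE /= -uv1; ring.
by apply: mx2_eq; rewrite !mxE sum_ord2 !mxE /= ?mulr1n ?mulr0n -?uv1; ring.
Qed.

(** Subtracting twice the determinant from the sum of the squared column norms
    gives [(U 0 0 - U 1 1) ^+ 2 + (U 0 1 + U 1 0) ^+ 2], which is therefore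
    [1 + 1 - 2 * 1 = 0]; this forces the shape of [U]. *)
Lemma rotation_rotP (R : realType) (U : 'M[R]_2) :
  rotation U -> exists u v : R, u ^+ 2 + v ^+ 2 = 1 /\ U = rot u v.
Proof.
move=> [/matrixP UTU]; rewrite det_mx2 => detU.
have := UTU 0 0; rewrite !mxE sum_ord2 !mxE mulr1n => col0.
have := UTU 1 1; rewrite !mxE sum_ord2 !mxE mulr1n => col1.
have /eqP : (U 0 0 - U 1 1) ^+ 2 + (U 0 1 + U 1 0) ^+ 2 = 0 by lra.
rewrite paddr_eq0 ?sqr_ge0 // !sqrf_eq0 => /andP[/eqP diag /eqP antidiag].
have U11 : U 1 1 = U 0 0 by lra.
have U10 : U 1 0 = - U 0 1 by lra.
exists (U 0 0), (U 0 1); split; first by rewrite -detU U11 U10; ring.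
by apply: mx2_eq; rewrite !mxE.
Qed.

Lemma enorm_sqr (R : realType) (v : 'cV[R]_2) :
  enorm v ^+ 2 = xcoord v ^+ 2 + ycoord v ^+ 2.
Proof. by rewrite /enorm sum_ord2 sqr_sqrtr // addr_ge0 ?sqr_ge0. Qed.

Section Alignment.

Variables (R : realType) (n : nat) (p q : 'I_n -> 'cV[R]_2).

Let a : R := \sum_(i < n) xcoord (q i) * xcoord (p i)
           + \sum_(i < n) ycoord (q i) * ycoord (p i).
Let b : R := \sum_(i < n) ycoord (q i) * xcoord (p i)
           - \sum_(i < n) xcoord (q i) * ycoord (p i).

Lemma Delta_rot (u v : R) : u ^+ 2 + v ^+ 2 = 1 ->
  Delta p q (rot u v) =
  \sum_(i < n) (enorm (q i) ^+ 2 + enorm (p i) ^+ 2) - 2 * (a * u + b * v).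
Proof.
move=> uv1; rewrite /a /b -sumrN -!big_split /= !mulr_suml -big_split /=.
rewrite mulr_sumr -sumrB; apply: eq_bigr => i _.
(* The coefficient 1 of |q_i|^2 is written [u ^+ 2 + v ^+ 2], which is what
   squaring [U *m q_i] produces. *)
rewrite !enorm_sqr -[X in _ = X + _ - _]mul1r -{1}uv1.
rewrite /xcoord /ycoord !mxE !sum_ord2 !mxE /=; ring.
Qed.

Lemma minimizes_Delta_rot (u v : R) : u ^+ 2 + v ^+ 2 = 1 ->
    (forall s t : R, s ^+ 2 + t ^+ 2 = 1 -> a * s + b * t <= a * u + b * v) ->
  minimizes_Delta p q (rot u v).
Proof.
move=> uv1 uv_max; split=> [|V]; first exact: rotation_rot.
case/rotation_rotP => s [t [st1 ->]].
by rewrite !Delta_rot // lerD2l lerN2 ler_pM2l // uv_max.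
Qed.

End Alignment.

(** Cauchy-Schwarz in the plane, against a unit vector. *)
Lemma dot_unit_le_norm (R : realType) (a b s t : R) : s ^+ 2 + t ^+ 2 = 1 ->
  a * s + b * t <= Num.sqrt (a ^+ 2 + b ^+ 2).
Proof.
move=> st1; apply: le_trans (ler_norm _) _; rewrite -sqrtr_sqr ler_wsqrtr //.
(* Lagrange's identity: the gap between the two sides is [(a t - b s)^2]. *)
rewrite -subr_ge0 -[a ^+ 2 + b ^+ 2]mulr1 -st1.
suff -> : (a ^+ 2 + b ^+ 2) * (s ^+ 2 + t ^+ 2) - (a * s + b * t) ^+ 2 =
          (a * t - b * s) ^+ 2 by exact: sqr_ge0.
by ring.
Qed.

Theorem theorem1 (R : realType) (n : nat) (p q : 'I_n -> 'cV[R]_2) :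
  let x i := xcoord (p i) in
  let y i := ycoord (p i) in
  let x' i := xcoord (q i) in
  let y' i := ycoord (q i) in
  let a := \sum_(i < n) x' i * x i + \sum_(i < n) y' i * y i in
  let b := \sum_(i < n) y' i * x i - \sum_(i < n) x' i * y i in
  let c := Num.sqrt (a ^+ 2 + b ^+ 2) in
  (a = 0 /\ b = 0 -> minimizes_Delta p q 1%:M) /\
  (~ (a = 0 /\ b = 0) ->
   minimizes_Delta p q (mx22 (a / c) (b / c) (- b / c) (a / c))).
Proof.
move=> x y x' y' a b c; split=> [[a0 b0] | ab_neq0].
  have -> : 1%:M = rot 1 0 :> 'M[R]_2 by apply: mx2_eq; rewrite !mxE ?oppr0.
  apply: minimizes_Delta_rot => [|s t _]; first by ring.
  by rewrite -/a -/b a0 b0 !mul0r.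
have c2E : c ^+ 2 = a ^+ 2 + b ^+ 2 by rewrite sqr_sqrtr // addr_ge0 ?sqr_ge0.
have c_neq0 : c != 0.
  apply/eqP => c0; apply: ab_neq0; move/eqP: c2E.
  rewrite c0 expr0n eq_sym paddr_eq0 ?sqr_ge0 // !sqrf_eq0.
  by case/andP => /eqP-> /eqP->.
rewrite mulNr; apply: minimizes_Delta_rot => [|s t st1].
  by rewrite !expr_div_n -mulrDl -c2E divff // expf_neq0.
suff -> : a * (a / c) + b * (b / c) = c by exact: dot_unit_le_norm.
by rewrite !mulrA -mulrDl -!expr2 -c2E expr2 mulfK.
Qed.
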